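(* Let $G$ be a finite simple graph that is $(P_2\cup P_4)$-free, diamond-free and $C_5$-free, with $\omega(G)\ge 5$. Then $G$ is perfect.
   Context: $P_t$ denotes the path and $C_t$ the cycle on $t$ vertices. For vertex-disjoint graphs $G_1,G_2$, $G_1\cup G_2$ is their disjoint union (no edges between them). A graph $G$ is $H$-free if no induced subgraph of $G$ is isomorphic to $H$. A diamond is the graph obtained from a $P_3$ by adding a new vertex adjacent to all three vertices of the $P_3$. $\omega(G)$ is the clique number. A graph is perfect if $\chi(H)=\omega(H)$ for every induced subgraph $H$. *)

(* Defs.v *)
From mathcomp Require Import all_boot.

Set Implicit Arguments.
Unset Strict Implicit.
Unset Printing Implicit Defensive.

Record sgraph := SGraph {
  vertex :> finType;
  adj : rel vertex;
  adj_sym : symmetric adj;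
  adj_irrefl : irreflexive adj
}.

Definition isomorphic (G H : sgraph) : Prop :=
  exists2 f : G -> H, bijective f & forall x y, adj (f x) (f y) = adj x y.

Section Induced.
Variables (G : sgraph) (S : {set G}).

Definition induced_adj : rel {x : G | x \in S} :=
  fun u v => adj (val u) (val v).

Lemma induced_adj_sym : symmetric induced_adj.
Proof. by move=> u v; apply: adj_sym. Qed.

Lemma induced_adj_irrefl : irreflexive induced_adj.
Proof. by move=> u; apply: adj_irrefl. Qed.

Definition induced : sgraph := SGraph induced_adj_sym induced_adj_irrefl.
End Induced.

Definition free (H G : sgraph) : Prop :=
  forall S : {set G}, ~ isomorphic (induced S) H.

Section PathCycle.
Variable t : nat.

Definition path_adj : rel 'I_t :=
  fun i j => (i.+1 == j :> nat) || (j.+1 == i :> nat).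

Lemma path_adj_sym : symmetric path_adj.
Proof. by move=> i j; rewrite /path_adj orbC. Qed.

Lemma path_adj_irrefl : irreflexive path_adj.
Proof. by move=> i; rewrite /path_adj orbb gtn_eqF. Qed.

Definition path_graph : sgraph := SGraph path_adj_sym path_adj_irrefl.

(* The condition i != j only matters for t = 1, where it excludes a loop. *)
Definition cycle_adj : rel 'I_t :=
  fun i j => (i != j) &&
    ((i.+1 %% t == j :> nat) || (j.+1 %% t == i :> nat)).

Lemma cycle_adj_sym : symmetric cycle_adj.
Proof. by move=> i j; rewrite /cycle_adj eq_sym orbC. Qed.

Lemma cycle_adj_irrefl : irreflexive cycle_adj.
Proof. by move=> i; rewrite /cycle_adj eqxx. Qed.

Definition cycle_graph : sgraph := SGraph cycle_adj_sym cycle_adj_irrefl.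
End PathCycle.

Section DisjointUnion.
Variables G1 G2 : sgraph.

Definition union_adj : rel (G1 + G2)%type := fun u v =>
  match u, v with
  | inl x, inl y => adj x y
  | inr x, inr y => adj x y
  | _, _ => false
  end.

Lemma union_adj_sym : symmetric union_adj.
Proof. by move=> [x|x] [y|y] //=; apply: adj_sym. Qed.

Lemma union_adj_irrefl : irreflexive union_adj.
Proof. by move=> [x|x] /=; apply: adj_irrefl. Qed.

Definition disjoint_union : sgraph := SGraph union_adj_sym union_adj_irrefl.
End DisjointUnion.

(* None is a new vertex, adjacent to every vertex of G. *)
Section Cone.
Variable G : sgraph.

Definition cone_adj : rel (option G) := fun u v =>
  match u, v with
  | Some x, Some y => adj x y
  | None, None => false
  | _, _ => true
  end.

Lemma cone_adj_sym : symmetric cone_adj.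
Proof. by move=> [x|] [y|] //=; apply: adj_sym. Qed.

Lemma cone_adj_irrefl : irreflexive cone_adj.
Proof. by move=> [x|] //=; apply: adj_irrefl. Qed.

Definition cone : sgraph := SGraph cone_adj_sym cone_adj_irrefl.
End Cone.

Definition diamond : sgraph := cone (path_graph 3).

Section Invariants.
Variable G : sgraph.

Definition clique (S : {set G}) : bool :=
  [forall x in S, forall y in S, (x != y) ==> adj x y].

Definition omega : nat := \max_(S : {set G} | clique S) #|S|.

Definition proper_coloring k (c : {ffun G -> 'I_k}) : bool :=
  [forall x, forall y, adj x y ==> (c x != c y)].

Definition colorable k : bool := [exists c : {ffun G -> 'I_k}, proper_coloring c].

Lemma colorable_card : colorable #|G|.
Proof.
apply/existsP; exists [ffun x => enum_rank x].
apply/forallP=> x; apply/forallP=> y; apply/implyP=> xy.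
by rewrite !ffunE (inj_eq enum_rank_inj); apply: contraTneq xy => ->; rewrite adj_irrefl.
Qed.

Definition chi : nat := ex_minn (ex_intro (fun k => colorable k) _ colorable_card).
End Invariants.

Definition perfect (G : sgraph) : Prop :=
  forall S : {set G}, chi (induced S) = omega (induced S).

(* Main.v *)
Require Import Defs.
From mathcomp Require Import all_boot.

Set Implicit Arguments.
Unset Strict Implicit.
Unset Printing Implicit Defensive.

(** Fix a maximum clique [K], of size at least 5. Diamond-freeness gives every
    vertex outside [K] at most one neighbour in [K], its foot. An induced P3
    outside [K] whose three vertices have distinct feet closes up to a C5
    through [K], and a P4 outside [K] either has such a P3 or misses two vertices
    of [K], which yields a P2 + P4; so the graph outside [K] is P4-free.

    To colour an induced subgraph with as many colours as its clique number,
    colour its part of [K] injectively and extend to the rest [T] by induction on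
    its size. Pieces of [T] without edges between them are treated separately.
    If [T] is connected, then either it has a dominating vertex [c], in which case
    [T] minus [c] is a disjoint union of cliques, each coloured by a Hall-type
    argument; or a vertex of maximum degree lies on an induced C4 and [T] is
    complete bipartite. In the latter case two vertices of a side may be assumed
    to have distinct feet (otherwise one can copy the colour of the other), so
    that the P3 rule leaves only a C4, coloured by hand. *)

(** * Forbidden induced subgraphs read as adjacency patterns *)

(** The image of [f] induces a copy of [H]: the corestriction [h] is injective, hence bijective by
    cardinality, and its inverse is the isomorphism that [free] excludes. *)
Lemma embedding_not_free (H G : sgraph) (f : H -> G) :
  injective f -> (forall x y, adj (f x) (f y) = adj x y) -> ~ free H G.
Proof.
move=> injf adjf /(_ (f @: [set: H])); apply.
have memf x : f x \in f @: [set: H] by rewrite imset_f ?inE.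
pose h x : induced (f @: [set: H]) := exist _ (f x) (memf x).
have injh : injective h by move=> x y /(congr1 val) /injf.
have [|g gK hK] := @inj_card_bij _ _ h injh.
  by rewrite card_sig -(card_imset predT injf); apply/subset_leq_card/subsetP => x;
     rewrite !inE => /imsetP [y _ ->]; rewrite imset_f.
exists g; first by exists h.
by move=> x y; rewrite -adjf -[in RHS](hK x) -[in RHS](hK y).
Qed.

(** Otherwise the path [x], [b], [y] with apex [a] is an induced diamond. *)
Lemma diamond_free_adj (G : sgraph) (a b x y : G) :
  free diamond G -> adj a b -> adj a x -> adj b x -> adj a y -> adj b y ->
  x != y -> adj x y.
Proof.
move=> dF ab ax bx ay by_ neq; apply/idPn=> nxy.
pose f (z : diamond) : G :=
  if z is Some i then nth a [:: x; b; y] (val (i : 'I_3)) else a.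
have xyE := negbTE nxy.
have adjf u v : adj (f u) (f v) = adj u v.
  move: u v => [[[|[|[|i]]] Hi]|] [[[|[|[|j]]] Hj]|] //=; rewrite /f /=;
  rewrite ?adj_irrefl // ?ab ?ax ?bx ?ay ?by_ ?xyE //
    adj_sym ?ab ?ax ?bx ?ay ?by_ ?xyE //.
apply: (embedding_not_free _ adjf dF) => u v fuv.
(* Equal images force equal neighbourhoods. Adjacency to the apex and to the middle vertex tells all
   pairs apart except the two ends of the path, which [neq] separates. *)
have E z : adj u z = adj v z by rewrite -!adjf fuv.
move: fuv (E None) (E (Some (@Ordinal 3 1 isT))).
move: u v {E} => [[[|[|[|i]]] Hi]|] [[[|[|[|j]]] Hj]|] //= fuv _ _;
  try (by congr Some; apply: val_inj);
  by move/eqP: neq; case; rewrite /f /= in fuv.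
Qed.

(** No two vertices of the 5-cycle have the same neighbours, so the adjacency pattern alone makes
    [f] injective. *)
Lemma C5_free_false (G : sgraph) (a b c d e : G) :
  free (cycle_graph 5) G ->
  adj a b -> adj b c -> adj c d -> adj d e -> adj e a ->
  ~~ adj a c -> ~~ adj a d -> ~~ adj b d -> ~~ adj b e -> ~~ adj c e -> False.
Proof.
move=> cF ab bc cd de ea ac ad bd be ce.
pose f (z : cycle_graph 5) : G := nth a [:: a; b; c; d; e] (val (z : 'I_5)).
have adjf x y : adj (f x) (f y) = adj x y.
  move: x y => [[|[|[|[|[|i]]]]] Hi] [[|[|[|[|[|j]]]]] Hj] //; rewrite /f /=;
  rewrite ?adj_irrefl ?ab ?bc ?cd ?de ?ea
    ?(negbTE ac) ?(negbTE ad) ?(negbTE bd) ?(negbTE be) ?(negbTE ce) //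
    adj_sym ?ab ?bc ?cd ?de ?ea
    ?(negbTE ac) ?(negbTE ad) ?(negbTE bd) ?(negbTE be) ?(negbTE ce) //.
apply: (embedding_not_free _ adjf cF) => x y fxy.
have E z : adj x z = adj y z by rewrite -!adjf fxy.
move: (E (@Ordinal 5 0 isT)) (E (@Ordinal 5 1 isT)) (E (@Ordinal 5 2 isT))
  (E (@Ordinal 5 3 isT)).
clear; move: x y => [[|[|[|[|[|i]]]]] Hi] [[|[|[|[|[|j]]]]] Hj] //= *; exact: val_inj.
Qed.

(** As for the 5-cycle, distinct vertices of P2 + P4 have distinct neighbourhoods, which gives
    injectivity. *)
Lemma P2P4_free_false (G : sgraph) (a b p q r s : G) :
  free (disjoint_union (path_graph 2) (path_graph 4)) G ->
  adj a b -> adj p q -> adj q r -> adj r s ->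
  ~~ adj p r -> ~~ adj p s -> ~~ adj q s ->
  {in [:: a; b] & [:: p; q; r; s], forall x y, ~~ adj x y} -> False.
Proof.
move=> hF ab pq qr rs pr ps qs cross.
pose f (z : disjoint_union (path_graph 2) (path_graph 4)) : G :=
  match z with
  | inl i => nth a [:: a; b] (val (i : 'I_2))
  | inr i => nth p [:: p; q; r; s] (val (i : 'I_4))
  end.
have crossE i j : i < 2 -> j < 4 ->
    adj (nth a [:: a; b] i) (nth p [:: p; q; r; s] j) = false.
  by move=> ltb ltj; apply/negbTE/cross; apply: mem_nth.
have adjf x y : adj (f x) (f y) = adj x y.
  move: x y => [[i Hi]|[i Hi]] [[j Hj]|[j Hj]]; rewrite /f.
  - move: i j Hi Hj => [|[|i]] [|[|j]] Hi Hj //=; rewrite ?adj_irrefl ?ab //.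
    by rewrite adj_sym ab.
  - exact: crossE.
  - rewrite adj_sym; exact: crossE.
  - move: i j Hi Hj => [|[|[|[|i]]]] [|[|[|[|j]]]] Hi Hj //=;
    rewrite ?adj_irrefl ?pq ?qr ?rs ?(negbTE pr) ?(negbTE ps) ?(negbTE qs) //
      adj_sym ?pq ?qr ?rs ?(negbTE pr) ?(negbTE ps) ?(negbTE qs) //.
apply: (embedding_not_free _ adjf hF) => x y fxy.
have E z : adj x z = adj y z by rewrite -!adjf fxy.
move: (E (inl (@Ordinal 2 0 isT))) (E (inl (@Ordinal 2 1 isT)))
  (E (inr (@Ordinal 4 0 isT))) (E (inr (@Ordinal 4 1 isT)))
  (E (inr (@Ordinal 4 2 isT))) (E (inr (@Ordinal 4 3 isT))).
clear; move: x y => [[[|[|i]] Hi]|[[|[|[|[|i]]]] Hi]] [[[|[|j]] Hj]|[[|[|[|[|j]]]] Hj]] //= *;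
  congr (_ _); exact: val_inj.
Qed.

(** * Cliques and the choice of distinct colours *)

Lemma clique_adj (G : sgraph) (C : {set G}) :
  reflect {in C &, forall x y, x != y -> adj x y} (clique C).
Proof.
apply: (iffP forall_inP) => [h x y xC yC|h x xC].
  exact/implyP/(forall_inP (h x xC)).
by apply/forall_inP=> y yC; apply/implyP/h.
Qed.

Lemma clique_leq (G : sgraph) (C : {set G}) : clique C -> #|C| <= omega G.
Proof. by move=> cC; apply: (@leq_bigmax_cond _ (fun S => clique S) (fun S => #|S|)). Qed.

Lemma clique_set1 (G : sgraph) (x : G) : clique [set x].
Proof. by apply/clique_adj=> y z /set1P -> /set1P ->; rewrite eqxx. Qed.

Lemma clique_setU1 (G : sgraph) (C : {set G}) (x : G) :
  clique C -> {in C, forall y, adj x y} -> clique (x |: C).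
Proof.
move=> /clique_adj cC xC; apply/clique_adj=> y z.
move=> /setU1P [->|yC] /setU1P [->|zC]; rewrite ?eqxx // => neq.
- exact: xC.
- by rewrite adj_sym; apply: xC.
- exact: cC.
Qed.

Lemma clique_sub (G : sgraph) (C D : {set G}) : C \subset D -> clique D -> clique C.
Proof.
move=> /subsetP CD /clique_adj cD; apply/clique_adj=> x y xC yC.
by apply: cD; apply: CD.
Qed.

Lemma clique3 (G : sgraph) (x y z : G) :
  adj x y -> adj x z -> adj y z ->
  clique [set x; y; z] /\ #|[set x; y; z]| = 3.
Proof.
move=> xy xz yz.
have E : [set x; y; z] = x |: (y |: [set z]) by rewrite setUA.
have adj_neq (u v : G) : adj u v -> u != v.
  by apply: contraTneq => ->; rewrite adj_irrefl.
rewrite E; split; last first.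
  by rewrite !cardsU1 cards1 !inE (negbTE (adj_neq _ _ xy)) (negbTE (adj_neq _ _ xz)) (adj_neq _ _ yz).
apply: clique_setU1 => [|u]; last by rewrite !inE => /orP [] /eqP ->.
by apply: clique_setU1 => [|u /set1P -> //]; apply: clique_set1.
Qed.

(* Hall's condition when every vertex forbids at most one colour: it can only
   fail if all the vertices forbid the same colour of a tight palette. *)
Lemma injective_choice (V I : finType) (i0 : I) (forb : V -> I -> bool)
    (Q : {set V}) (L : {set I}) :
  (forall u a b, forb u a -> forb u b -> a = b) ->
  #|Q| <= #|L| ->
  (#|Q| = #|L| -> Q != set0 -> forall a, a \in L -> exists2 u, u \in Q & ~~ forb u a) ->
  exists2 g : V -> I, {in Q &, injective g} &
    forall u, u \in Q -> (g u \in L) && ~~ forb u (g u).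
Proof.
move=> forb_fun; have [n] := ubnP #|Q|.
elim: n Q L => // n IHn Q L leQn leQL tight.
have [->|[u0 u0Q]] := set_0Vmem Q.
  by exists (fun=> i0) => [x y|x]; rewrite inE.
(* One vertex [u] takes a colour [a], chosen so that the hypotheses survive the removal of both;
   induction treats the rest. *)
suff [u [a [uQ aL fua rest]]] : exists u a, [/\ u \in Q, a \in L, ~~ forb u a &
    #|Q :\ u| = #|L :\ a| -> Q :\ u != set0 ->
    forall b, b \in L :\ a -> exists2 x, x \in Q :\ u & ~~ forb x b].
  have cQ : #|Q| = #|Q :\ u|.+1 by rewrite (cardsD1 u Q) uQ.
  have cL : #|L| = #|L :\ a|.+1 by rewrite (cardsD1 a L) aL.
  have [||//|g injg gP] := IHn (Q :\ u) (L :\ a).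
  - by rewrite -ltnS -cQ.
  - by rewrite -ltnS -cQ -cL.
  exists (fun x => if x == u then a else g x).
    move=> x y xQ yQ /=; case: eqP => [->|/eqP xu]; case: eqP => [->|/eqP yu] //.
    + move=> E; have /gP : y \in Q :\ u by rewrite !inE yu.
      by rewrite -E !inE eqxx.
    + move=> E; have /gP : x \in Q :\ u by rewrite !inE xu.
      by rewrite E !inE eqxx.
    + by apply: injg; rewrite !inE ?xu ?yu.
  move=> x xQ; case: eqP => [->|/eqP xu]; first by rewrite aL.
  have /gP : x \in Q :\ u by rewrite !inE xu.
  by rewrite !inE => /andP [/andP [_ ->]].
(* Suppose [a] is allowed for [u] but forbidden to [u']. Once [u] takes it, [u'] remains and,
   forbidding only [a], accepts every remaining colour. *)
have [/exists_inP [a aL /andP [/exists_inP [u' u'Q fu'a] /exists_inP [u uQ fua]]]|mixed] :=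
  boolP [exists a in L, [exists u in Q, forb u a] && [exists u in Q, ~~ forb u a]].
  exists u, a; split=> // _ _ b /setD1P [ba bL]; exists u'.
    by rewrite !inE u'Q andbT; apply: contraNneq fua => <-.
  by apply: contra ba => fu'b; rewrite (forb_fun _ _ _ fu'a fu'b).
have {mixed}uniform a u v : a \in L -> u \in Q -> v \in Q -> forb u a -> forb v a.
  move=> aL uQ vQ fua; apply: contraR mixed => fva.
  by apply/exists_inP; exists a => //; apply/andP; split; apply/exists_inP; [exists u|exists v].
(* Each colour of [L] is now forbidden to all of [Q] or to none. If one is forbidden to all, [tight]
   makes [L] strictly larger than [Q]; giving [u0] another colour keeps it so, and the tight case
   cannot arise later. *)
have [/exists_inP [a aL fa]|free] := boolP [exists a in L, forb u0 a].
  have ltQL : #|Q| < #|L|.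
    rewrite ltn_neqAle leQL andbT; apply/eqP => /tight.
    have -> : Q != set0 by apply/set0Pn; exists u0.
    move=> /(_ isT a aL) [u uQ]; by rewrite (uniform a u0 u).
  have /card_gt0P [b] : 0 < #|L :\ a|.
    rewrite -ltnS; apply: leq_trans (_ : #|L| <= _); last by rewrite (cardsD1 a L) aL.
    by apply: leq_ltn_trans ltQL; rewrite card_gt0; apply/set0Pn; exists u0.
  case/setD1P => ba bL; exists u0, b; split=> //.
    by apply: contra ba => fb; rewrite (forb_fun _ _ _ fa fb).
  move=> E; move: ltQL; rewrite (cardsD1 u0 Q) (cardsD1 b L) u0Q bL E.
  by rewrite ltnn.
have none a u : a \in L -> u \in Q -> ~~ forb u a.
  move=> aL uQ; apply: contra free => fua; apply/exists_inP; exists a => //.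
  exact: (uniform a u).
have /card_gt0P [a aL] : 0 < #|L|.
  by apply: leq_trans leQL; rewrite card_gt0; apply/set0Pn; exists u0.
exists u0, a; split=> //; first exact: none.
by move=> _ /set0Pn [x xQ] b /setD1P [_ bL]; exists x => //; apply: none => //; case/setD1P: xQ.
Qed.

(** * Extending a partial colouring *)

Section Extension.

Variables (G : sgraph) (I : finType).
Implicit Types (P T Q R : {set G}) (f : G -> I).

Definition proper_on (D : {set G}) f := {in D &, forall x y, adj x y -> f x != f y}.

Definition extendable P f0 T :=
  exists2 f, {in P, f =1 f0} & proper_on (P :|: T) f.

(** Both colourings equal [f0] on [P], and every edge lies within [P :|: T1] or within
    [P :|: T2]. *)
Lemma extendable_glue P f0 T1 T2 :
  {in T1 & T2, forall x y, ~~ adj x y} ->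
  extendable P f0 T1 -> extendable P f0 T2 -> extendable P f0 (T1 :|: T2).
Proof.
move=> anti [f1 f1P p1] [f2 f2P p2].
pose f x := if x \in T1 then f1 x else f2 x.
have fP : {in P, f =1 f0} by move=> x xP; rewrite /f; case: ifP => _; [apply: f1P|apply: f2P].
have fE1 x : x \in P :|: T1 -> f x = f1 x.
  by rewrite inE /f; case: ifP => // _; rewrite orbF => xP; rewrite f1P ?f2P.
exists f => // x y xD yD xy.
have fE2 z : z \in P :|: (T1 :|: T2) -> z \notin P :|: T1 ->
    [/\ z \in T2, z \in P :|: T2 & f z = f2 z].
  rewrite /f !inE !negb_or => zD /andP [/negbTE zP /negbTE z1].
  by move: zD; rewrite zP z1 /= => ->.
have fEP z : z \in P -> f z = f2 z by move=> zP; rewrite fP ?f2P.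
have PT z : z \in P -> z \in P :|: T2 by rewrite inE => ->.
have [x1|x1] := boolP (x \in P :|: T1); have [y1|y1] := boolP (y \in P :|: T1).
- by rewrite !fE1 //; apply: p1.
- have [y2 yP2 ->] := fE2 y yD y1; have [xP|xP] := boolP (x \in P).
    by rewrite fEP //; apply: p2 => //; apply: PT.
  move: x1; rewrite inE (negbTE xP) /= => x1.
  by move: xy; rewrite (negbTE (anti _ _ x1 y2)).
- have [x2 xP2 ->] := fE2 x xD x1; have [yP|yP] := boolP (y \in P).
    by rewrite fEP //; apply: p2 => //; apply: PT.
  move: y1; rewrite inE (negbTE yP) /= => y1.
  by move: xy; rewrite adj_sym (negbTE (anti _ _ y1 x2)).
- have [_ xP2 ->] := fE2 x xD x1; have [_ yP2 ->] := fE2 y yD y1.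
  exact: p2.
Qed.

(** Transitivity makes the components of [R] cliques: the closed neighbourhood of a vertex is split
    off as a clique and glued to the rest. *)
Lemma extendable_clusters P f0 R :
  {in R & &, forall x y z, adj x y -> adj y z -> x != z -> adj x z} ->
  (forall Q, Q \subset R -> clique Q -> extendable P f0 Q) ->
  extendable P f0 R.
Proof.
have [n] := ubnP #|R|; elim: n R => // n IHn R leRn cluster extQ.
have [->|[q qR]] := set_0Vmem R.
  by apply: extQ; rewrite ?sub0set //; apply/clique_adj=> x; rewrite inE.
pose Q := [set x in R | (x == q) || adj q x].
have QR : Q \subset R by apply/subsetP=> x; rewrite inE => /andP [].
have DR : R :\: Q \subset R by apply: subsetDl.
rewrite -(setID R Q) (setIidPr QR); apply: extendable_glue.
- move=> x y; rewrite !inE => /andP [xR qx] /andP [nQ yR].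
  move: nQ; rewrite yR /= negb_or => /andP [yq]; apply: contra => xy.
  case/orP: qx => [/eqP <- //|qx]; apply: (cluster q x y) => //.
  by rewrite eq_sym.
- apply: extQ => //; apply/clique_adj=> x y.
  rewrite !inE => /andP [xR] /orP [/eqP ->|qx] /andP [yR] /orP [/eqP ->|qy];
    rewrite ?eqxx // => neq.
  + by rewrite adj_sym.
  + by apply: (cluster x q y) => //; rewrite adj_sym.
- apply: IHn.
  + rewrite ltnS in leRn; apply: leq_trans leRn; apply/proper_card/properP; split=> //.
    by exists q => //; rewrite !inE qR eqxx.
  + by move=> x y z xR yR zR; apply: cluster; apply: (subsetP DR).
  + by move=> Q' Q'D; apply: extQ; apply: subset_trans DR.
Qed.

Lemma extendable_injective P f0 Q (g : G -> I) :
  [disjoint P & Q] -> proper_on P f0 -> {in Q &, injective g} ->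
  {in Q & P, forall u v, adj u v -> g u != f0 v} -> extendable P f0 Q.
Proof.
move=> dPQ pP injg gP; exists (fun x => if x \in Q then g x else f0 x).
  by move=> x xP; rewrite (disjointFr dPQ).
move=> x y; rewrite !inE; case: (boolP (x \in Q)) => xQ; case: (boolP (y \in Q)) => yQ;
  rewrite ?orbT ?orbF // => xP yP xy.
- apply: contraTneq xy => /injg -> //; by rewrite adj_irrefl.
- exact: gP.
- by rewrite eq_sym; apply: gP => //; rewrite adj_sym.
- exact: pP.
Qed.

(** The colour of [x'] can be copied to [x]. Taking [z] to be [x'] in the inclusion of
    neighbourhoods shows that the two are not adjacent. *)
Lemma extendable_comparable P f0 T x x' :
  x \notin P -> x' \in T -> x != x' ->
  {in P :|: T, forall z, adj x z -> adj x' z} ->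
  extendable P f0 (T :\ x) -> extendable P f0 T.
Proof.
move=> xP x'T neq sub [f fP pf].
exists (fun z => if z == x then f x' else f z).
  by move=> z zP; case: eqP => [E|_]; [rewrite -E zP in xP|apply: fP].
have memD z : z \in P :|: T -> z != x -> z \in P :|: T :\ x.
  by rewrite !inE => /orP [->//|->] ->; rewrite orbT.
have x'D : x' \in P :|: T :\ x by rewrite !inE x'T eq_sym neq orbT.
move=> y z yD zD /=; case: (eqVneq y x) => [->|yx]; case: (eqVneq z x) => [->|zx] yz.
- by rewrite adj_irrefl in yz.
- by apply: pf => //; [apply: memD|apply: sub].
- by rewrite eq_sym; apply: pf => //; [apply: memD|apply: sub; rewrite // adj_sym].
- by apply: pf => //; apply: memD.
Qed.

End Extension.

(** * Feet in the clique *)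

Section OutsideClique.

Variables (G : sgraph) (K : {set G}).
Hypothesis diamondP : forall a b x y : G,
  adj a b -> adj a x -> adj b x -> adj a y -> adj b y -> x != y -> adj x y.
Hypothesis C5P : forall a b c d e : G,
  adj a b -> adj b c -> adj c d -> adj d e -> adj e a ->
  ~~ adj a c -> ~~ adj a d -> ~~ adj b d -> ~~ adj b e -> ~~ adj c e -> False.
Hypothesis cliqueK : clique K.
Hypothesis footK : forall u v v' : G, u \notin K -> v \in K -> v' \in K ->
  adj u v -> adj u v' -> v = v'.

(** Otherwise [p], [q], [r], [v'], [v] is an induced C5; uniqueness of feet excludes the chords
    [p v'] and [r v]. *)
Lemma P3_foot p q r v v' :
  p \notin K -> q \notin K -> r \notin K -> adj p q -> adj q r -> ~~ adj p r ->
  v \in K -> v' \in K -> adj p v -> adj r v' -> v != v' -> adj q v \/ adj q v'.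
Proof.
move=> pK qK rK pq qr pr vK v'K pv rv' neq.
have [|nqv] := boolP (adj q v); first by left.
have [|nqv'] := boolP (adj q v'); first by right.
case: (@C5P p q r v' v) => //.
- by rewrite adj_sym; apply: (clique_adj _ cliqueK).
- by rewrite adj_sym.
- by apply: contra neq => pv'; rewrite (footK pK vK v'K).
- by apply: contra neq => rv; rewrite (footK rK vK v'K).
Qed.

(** By [P3_foot], each pair among [va], [vb], [vc] contains a foot of [q]; but [q] has only one
    foot, and no vertex lies in all three pairs. *)
Lemma no_three_feet q a b c va vb vc :
  q \notin K -> a \notin K -> b \notin K -> c \notin K ->
  adj q a -> adj q b -> adj q c -> ~~ adj a b -> ~~ adj a c -> ~~ adj b c ->
  va \in K -> vb \in K -> vc \in K -> adj a va -> adj b vb -> adj c vc ->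
  va != vb -> va != vc -> vb != vc -> False.
Proof.
move=> qK aK bK cK qa qb qc ab ac bc vaK vbK vcK ava bvb cvc nab nac nbc.
have aq : adj a q by rewrite adj_sym.
have bq : adj b q by rewrite adj_sym.
have H1 := P3_foot aK qK bK aq qb ab vaK vbK ava bvb nab.
have H2 := P3_foot aK qK cK aq qc ac vaK vcK ava cvc nac.
have H3 := P3_foot bK qK cK bq qc bc vbK vcK bvb cvc nbc.
have F u v : u \in K -> v \in K -> u != v -> adj q u -> adj q v -> False.
  by move=> uK vK /eqP uv qu qv; apply: uv; apply: (footK qK).
case: H1 => H1; case: H2 => H2; case: H3 => H3;
  solve [exact: (F va vb) | exact: (F va vc) | exact: (F vb vc)].
Qed.

Lemma P4_free_outside p q r s :
  free (disjoint_union (path_graph 2) (path_graph 4)) G -> 5 <= #|K| ->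
  p \notin K -> q \notin K -> r \notin K -> s \notin K ->
  adj p q -> adj q r -> adj r s -> ~~ adj p r -> ~~ adj p s -> ~~ adj q s -> False.
Proof.
move=> PP K5 pK qK rK sK pq qr rs pr ps qs.
pose feet u := [set v in K | adj u v].
have cfeet u : u \notin K -> #|feet u| <= 1.
  move=> uK; apply/card_le1_eqP => x y; rewrite !inE => /andP [xK ux] /andP [yK uy].
  exact: (footK uK).
pose F := feet p :|: feet q :|: feet r :|: feet s.
have FK : F \subset K by apply/subsetP=> x; rewrite !inE => /orP [/orP [/orP [] |]|] /andP [].
(* Two vertices of [K] that are not feet of the path form a P2 + P4 with it. *)
have [/card_gt1P [v [v' [vD v'D neq]]]|small] := ltnP 1 #|K :\: F|.
  have freeD x y : x \in K :\: F -> y \in [:: p; q; r; s] -> ~~ adj x y.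
    rewrite !inE => /andP []; have [xK|//] := boolP (x \in K).
    rewrite !negb_or /= => /andP [/andP [/andP [px qx] rx] sx] _.
    by rewrite adj_sym => /or4P [] /eqP ->.
  apply: (P2P4_free_false PP _ pq qr rs pr ps qs (a := v) (b := v')).
    apply: (clique_adj _ cliqueK) => //; exact: (subsetP (subsetDl K F)).
  move=> x y xv; apply: freeD; move: xv.
  by rewrite in_cons mem_seq1 => /orP [] /eqP ->.
have F4 : 4 <= #|F|.
  have := cardsID F K; rewrite (setIidPr FK) => E.
  rewrite -(leq_add2r #|K :\: F|) E; apply: leq_trans K5.
  by rewrite -[5]/(4 + 1) leq_add2l.
have cU (A B : {set G}) m n : #|A| <= m -> #|B| <= n -> #|A :|: B| <= m + n.
  by move=> Am Bn; apply: leq_trans (leq_card_setU _ _).1 _; apply: leq_add.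
(* With [s] this leaves at most three feet, against [F4]. If [p] and [r] have different feet,
   [P3_foot] makes [q] share one of them. *)
suff : #|feet p :|: feet q :|: feet r| <= 2.
  by move=> /cU /(_ (cfeet _ sK)) H; rewrite /F in F4; have := leq_trans F4 H.
have [->|[v]] := set_0Vmem (feet p).
  by rewrite set0U; apply: (cU _ _ 1 1); apply: cfeet.
have [->|[v']] := set_0Vmem (feet r).
  by rewrite setU0 => _; apply: (cU _ _ 1 1); apply: cfeet.
rewrite !inE => /andP [v'K rv'] /andP [vK pv].
have feetE u w : u \notin K -> w \in K -> adj u w -> feet u = [set w].
  move=> uK wK uw; apply/setP=> x; rewrite !inE.
  apply/andP/eqP => [[xK ux]|->//]; exact: (footK uK).
rewrite (feetE p v) // (feetE r v') //.
have [<-|neq] := eqVneq v v'.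
  rewrite setUAC setUid; apply: (cU _ _ 1 1); rewrite ?cards1 //; exact: cfeet.
have [qv|qv'] := P3_foot pK qK rK pq qr pr vK v'K pv rv' neq.
  by rewrite (feetE q v) // setUid; apply: (cU _ _ 1 1); rewrite cards1.
by rewrite (feetE q v') // -setUA setUid; apply: (cU _ _ 1 1); rewrite cards1.
Qed.

(** * Connected P4-free pieces *)

Hypothesis P4P : forall p q r s : G,
  p \notin K -> q \notin K -> r \notin K -> s \notin K ->
  adj p q -> adj q r -> adj r s -> ~~ adj p r -> ~~ adj p s -> ~~ adj q s -> False.

Definition complete_bipartite (T X Y : {set G}) :=
  [/\ T = X :|: Y, {in X &, forall x y, ~~ adj x y},
      {in Y &, forall x y, ~~ adj x y} & {in X & Y, forall x y, adj x y}].

(** Stated through cuts rather than paths: it is used to show that a set closed under adjacency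
    exhausts [T], and its failure yields a split for [extendable_glue]. *)
Definition connected (T : {set G}) :=
  forall T1 : {set G}, T1 \subset T -> T1 != set0 ->
  {in T1 & T :\: T1, forall x y, ~~ adj x y} -> T1 = T.

(** The sides are the common neighbours of the two opposite pairs of the C4. An edge inside a side
    would give a diamond, a missing edge between the sides a P4. *)
Lemma connected_C4 (T : {set G}) c m t p :
  [disjoint T & K] -> connected T ->
  c \in T -> m \in T -> t \in T -> p \in T ->
  adj c m -> adj m t -> adj t p -> adj p c -> ~~ adj c t -> ~~ adj m p -> c != t -> m != p ->
  complete_bipartite T [set z in T | adj z m && adj z p] [set z in T | adj z c && adj z t].
Proof.
move=> dTK conT cT mT tT pT cm mt tp pc nct nmp ct mp.
have TK x : x \in T -> x \notin K by move=> xT; rewrite (disjointFr dTK).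
set X := [set z in T | _]; set Y := [set z in T | _].
have XI : {in X &, forall x y, ~~ adj x y}.
  move=> x y; rewrite !inE => /and3P [xT xm xp] /and3P [yT ym yp].
  apply: contra nmp => xy; exact: (diamondP xy).
have YI : {in Y &, forall x y, ~~ adj x y}.
  move=> x y; rewrite !inE => /and3P [xT xm xp] /and3P [yT ym yp].
  apply: contra nct => xy; exact: (diamondP xy).
have cX : c \in X by rewrite inE cT cm adj_sym pc.
have tX : t \in X by rewrite inE tT tp adj_sym mt.
have mY : m \in Y by rewrite inE mT mt adj_sym cm.
have pY : p \in Y by rewrite inE pT pc adj_sym tp.
have XY : {in X & Y, forall x y, adj x y}.
  move=> x y xX yY; apply/idPn => nxy.
  have nxc := XI _ _ xX cX; have nmy := YI _ _ mY yY.
  move: xX yY; rewrite !inE => /and3P [xT xm xp] /and3P [yT yc yt].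
  by apply: (P4P (TK x xT) (TK m mT) (TK c cT) (TK y yT) xm) => //; rewrite adj_sym.
(* A vertex attached to [a] on an induced C4 [a b d e] also sees [d], or else both [b] and [e];
   otherwise a P4 starts at [z]. Hence [X :|: Y] is closed under adjacency. *)
have attach z a b d e : z \in T -> a \in T -> b \in T -> d \in T -> e \in T ->
    adj a b -> adj b d -> adj d e -> adj e a -> ~~ adj a d -> ~~ adj b e -> a != d -> b != e ->
    adj z a -> adj z d || (adj z b && adj z e).
  move=> zT aT bT dT eT ab bd de ea nad nbe ad be za.
  have [//|nzd] := boolP (adj z d) => /=; apply/andP; split; apply/idPn => nz.
  - by apply: (P4P (TK z zT) (TK a aT) (TK b bT) (TK d dT) za).
  - by apply: (P4P (TK z zT) (TK a aT) (TK e eT) (TK d dT) za) => //; rewrite adj_sym.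
have closed z z' : z \in T -> z' \in X :|: Y -> adj z z' -> z \in X :|: Y.
  move=> zT /setUP [z'X|z'Y] zz'; rewrite !inE zT /=.
    have z'T : z' \in T by move: z'X; rewrite inE => /andP [].
    have A u : u \in X -> (adj z m && adj z p) || adj z u.
      move=> uX; have [<-|z'u] := eqVneq z' u; first by rewrite zz' orbT.
      rewrite orbC; apply: (attach z z' m u p) => //; try exact: XI; try exact: XY.
      - by move: uX; rewrite inE => /andP [].
      - by rewrite adj_sym; apply: XY.
      - by rewrite adj_sym; apply: XY.
    by move: (A c cX) (A t tX); case: (_ && _) => //= -> ->.
  have z'T : z' \in T by move: z'Y; rewrite inE => /andP [].
  have A u : u \in Y -> (adj z c && adj z t) || adj z u.
    move=> uY; have [<-|z'u] := eqVneq z' u; first by rewrite zz' orbT.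
    rewrite orbC; apply: (attach z z' c u t) => //; try exact: YI; try exact: XY.
    - by move: uY; rewrite inE => /andP [].
    - by rewrite adj_sym; apply: XY.
    - by rewrite adj_sym; apply: XY.
  by move: (A m mY) (A p pY); case: (adj z c && adj z t) => /= [|-> ->] //; rewrite orbT.
split=> //; apply/esym/conT.
- by apply/subsetP=> z; rewrite !inE => /orP [] /andP [].
- by apply/set0Pn; exists c; rewrite inE cX.
- move=> x y xU /setDP [yT]; apply: contra => xy; apply: (closed y x) => //.
  by rewrite adj_sym.
Qed.

Lemma connected_cases (T : {set G}) :
  [disjoint T & K] -> T != set0 -> connected T ->
  (exists2 c, c \in T & {in T, forall z, z != c -> adj c z}) \/
  (exists X Y, [/\ complete_bipartite T X Y, 1 < #|X| & 1 < #|Y|]).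
Proof.
move=> dTK /set0Pn [c0 c0T] conT.
have TK x : x \in T -> x \notin K by move=> xT; rewrite (disjointFr dTK).
have [c cT cmax] := @arg_maxnP _ c0 [in T] (fun u => #|[set z in T | adj u z]|) c0T.
have [dom|] := boolP [forall z in T, (z != c) ==> adj c z].
  by left; exists c => // z zT; apply/implyP/(forall_inP dom).
move=> /forall_inPn [z0 z0T]; rewrite negb_imply => /andP [z0c ncz0]; right.
pose T1 := [set z in T | (z == c) || adj c z].
have T1T : T1 \subset T by apply/subsetP=> z; rewrite inE => /andP [].
have [m [t [mT tT cm mt /andP [ncT tc]]]] : exists m t,
    [/\ m \in T, t \in T, adj c m, adj m t & ~~ adj c t && (t != c)].
  have [/existsP [m /existsP [t /and5P [mT tT cm mt /andP [nct tc]]]]|none] :=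
    boolP [exists m, exists t,
      [&& m \in T, t \in T, adj c m, adj m t, ~~ adj c t & t != c]].
    by exists m, t; split=> //; rewrite nct.
  have E : T1 = T.
    apply: conT => //; first by apply/set0Pn; exists c; rewrite inE cT eqxx.
    move=> x y; rewrite !inE => /andP [xT xc] /andP [nT1 yT].
    move: nT1; rewrite yT /= negb_or => /andP [yc ncy].
    apply: contra none => xy; apply/existsP; exists x; apply/existsP; exists y.
    rewrite xT yT xy ncy yc !andbT /=; case/orP: xc => // /eqP E.
    by rewrite -E xy in ncy.
  by move: z0T; rewrite -E inE (negbTE z0c) (negbTE ncz0) andbF.
(* By maximality [m] has no more neighbours than [c]. Among those of [m], both [t] and [c] lie
   outside the neighbourhood of [c], so [c] has a neighbour [p] other than [m] that [m] misses. Then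
   P4-freeness of [p], [c], [m], [t] closes the C4. *)
have [p pT [cp nmp pm]] : exists2 p, p \in T & [/\ adj c p, ~~ adj m p & p != m].
  pose N u := [set z in T | adj u z].
  have cm1 : #|N c| = #|N c :\ m|.+1 by rewrite (cardsD1 m (N c)) inE mT cm.
  have mt1 : #|N m| = #|N m :\ t|.+1 by rewrite (cardsD1 t (N m)) inE tT mt.
  have mc1 : #|N m :\ t| = #|N m :\ t :\ c|.+1.
    by rewrite (cardsD1 c (N m :\ t)) !inE cT eq_sym tc adj_sym cm.
  have /subsetPn [p] : ~~ (N c :\ m \subset N m :\ t :\ c).
    apply/negP => /subset_leq_card; apply/negP; rewrite -ltnNge.
    by have le : #|N m| <= #|N c| := cmax m mT; rewrite cm1 mt1 mc1 ltnS in le.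
  rewrite !inE => /and3P [pm pT cp] H; exists p => //; split=> //.
  have pc : p != c by apply: contraTneq cp => ->; rewrite adj_irrefl.
  have pt : p != t by apply: contraNneq ncT => <-.
  by move: H; rewrite pT pc pt.
have mc : adj m c by rewrite adj_sym.
have pc : adj p c by rewrite adj_sym.
have npm : ~~ adj p m by rewrite adj_sym.
have tp : adj t p.
  apply/idPn=> ntp.
  by apply: (P4P (TK p pT) (TK c cT) (TK m mT) (TK t tT)) => //; rewrite adj_sym.
do 2 eexists; split.
- by apply: (connected_C4 dTK conT cT mT tT pT); rewrite // eq_sym.
- apply/card_gt1P; exists c, t; split; rewrite ?inE ?cT ?tT ?cm ?cp ?tp 1?eq_sym //.
  by rewrite adj_sym mt.
- apply/card_gt1P; exists m, p; split; rewrite ?inE ?mT ?pT ?mc ?pc ?mt 1?eq_sym //.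
  by rewrite adj_sym tp.
Qed.

(** * Colouring the pieces outside the clique *)

Section Colour.

Variables (I : finType) (i0 : I) (K' : {set G}) (f0 : G -> I).
Hypothesis subK : K' \subset K.
Hypothesis injf0 : {in K' &, injective f0}.

Lemma proper_on_injective : proper_on K' f0.
Proof.
move=> x y xK yK xy; apply: contraTneq xy => /injf0 -> //.
by rewrite adj_irrefl.
Qed.

Lemma extendable_dominated (T : {set G}) c :
  [disjoint T & K] -> c \in T -> {in T, forall z, z != c -> adj c z} ->
  (forall C : {set G}, C \subset K' :|: T -> clique C -> #|C| <= #|I|) ->
  extendable K' f0 T.
Proof.
move=> dTK cT dom cliqueI.
have TK x : x \in T -> x \notin K by move=> xT; rewrite (disjointFr dTK).
have K'K x : x \in K' -> x \in K by apply: (subsetP subK).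
have foot' u v v' : u \in T -> v \in K' -> v' \in K' -> adj u v -> adj u v' -> v = v'.
  by move=> uT vK v'K; apply: footK; [apply: TK|apply: K'K|apply: K'K].
have no_triangle x y z : #|I| = 2 -> x \in K' :|: T -> y \in K' :|: T -> z \in K' :|: T ->
    adj x y -> adj x z -> adj y z -> False.
  move=> I2 xD yD zD xy xz yz; have [cl c3] := clique3 xy xz yz.
  suff : #|[set x; y; z]| <= #|I| by rewrite c3 I2.
  by apply: cliqueI => //; apply/subsetP=> u /setUP [/set2P [] ->|/set1P ->].
have TD x : x \in T -> x \in K' :|: T by rewrite inE => ->; rewrite orbT.
have KD x : x \in K' -> x \in K' :|: T by rewrite inE => ->.
pose R := T :\ c.
have RT x : x \in R -> [/\ x \in T, adj c x & x != c].
  by case/setD1P=> xc xT; split=> //; apply: dom.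
(* The colour [a] is meant for [c]. With only two colours, a lone vertex of [R] must take the other
   one, so its foot has to be coloured [a]. *)
have [a aP a2] : exists2 a : I, {in K', forall v, adj c v -> f0 v != a} &
    #|I| = 2 -> {in R & K', forall q v, adj q v -> f0 v = a}.
  (* A foot [v] of [R] not adjacent to [c] supplies [a]. With two colours, a second foot [v'] would
     by [P3_foot] be adjacent to [c] and close a triangle. *)
  have [/exists_inP [q qR /exists_inP [v vK /andP [qv ncv]]]|none] :=
    boolP [exists q in R, exists v in K', adj q v && ~~ adj c v].
    have [qT cq qc] := RT q qR.
    exists (f0 v) => [v' v'K cv'|I2 q' v' q'R v'K q'v'].
      by apply: contraNneq ncv => /injf0 <-.
    have [q'T cq' q'c] := RT q' q'R.
    have [-> //|neq] := eqVneq v v'.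
    have nqq' : ~~ adj q q'.
      by apply/negP => qq'; apply: (no_triangle c q q') => //; apply: TD.
    have qcadj : adj q c by rewrite adj_sym.
    have [cv|cv'] := P3_foot (TK q qT) (TK c cT) (TK q' q'T) qcadj cq' nqq'
      (K'K _ vK) (K'K _ v'K) qv q'v' neq.
      by rewrite cv in ncv.
    by case: (no_triangle c q' v') => //; [apply: TD|apply: TD|apply: KD].
  (* Now every foot of [R] in [K'] is adjacent to [c], which is a triangle and rules out two
     colours. So [a] need only avoid the colour of the foot of [c], if there is one. *)
  have below : {in R & K', forall q v, adj q v -> adj c v}.
    move=> q v qR vK qv; apply: contraR none => ncv.
    by apply/exists_inP; exists q => //; apply/exists_inP; exists v => //; rewrite qv.
  have vac a : #|I| = 2 -> {in R & K', forall q v, adj q v -> f0 v = a}.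
    move=> I2 q v qR vK qv; have [qT cq qc] := RT q qR.
    case: (no_triangle c q v) => //; [exact: TD|exact: TD|exact: KD|].
    exact: below qv.
  have [/exists_inP [v vK cv]|nov] := boolP [exists v in K', adj c v]; last first.
    exists i0; last exact: vac.
    move=> v vK cv; apply: contraNneq nov => _; by apply/exists_inP; exists v.
  have I1 : 1 < #|I|.
    apply: leq_trans (cliqueI [set c; v] _ _).
    - rewrite cards2 (_ : c != v) //.
      by apply: contraTneq cv => ->; rewrite adj_irrefl.
    - by apply/subsetP=> x; rewrite !inE => /orP [] /eqP ->; rewrite ?cT ?vK ?orbT.
    - by apply: clique_setU1 => [|x /set1P -> //]; apply: clique_set1.
  have /card_gt0P [a] : 0 < #|[set~ f0 v]| by rewrite cardsC1 -ltnS prednK // ltnW.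
  rewrite !inE => av; exists a; last exact: vac.
  by move=> v' v'K cv'; rewrite (foot' c v' v) // eq_sym.
pose f1 x := if x == c then a else f0 x.
have cK' : c \notin K' by apply: contra (TK c cT); apply: K'K.
have f1K x : x \in K' -> f1 x = f0 x.
  by move=> xK; rewrite /f1; case: eqP => // E; rewrite -E xK in cK'.
have f1c : f1 c = a by rewrite /f1 eqxx.
suff [f fE pf] : extendable (c |: K') f1 R.
  exists f => [x xK|]; first by rewrite fE ?f1K // !inE xK orbT.
  suff -> : K' :|: T = (c |: K') :|: R by [].
  by rewrite -(setD1K cT) setUCA setUA.
have pf1 : proper_on (c |: K') f1.
  move=> x y /setU1P [->|xK] /setU1P [->|yK]; rewrite ?adj_irrefl ?f1c ?f1K // => xy.
  - by rewrite eq_sym; apply: aP.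
  - by apply: aP; rewrite // adj_sym.
  - exact: proper_on_injective.
(* As [c] is adjacent to all of [R], diamond-freeness makes adjacency on [R] transitive. *)
apply: extendable_clusters.
  move=> x y z xR yR zR xy yz xz.
  have [xT cx _] := RT x xR; have [yT cy _] := RT y yR; have [zT cz _] := RT z zR.
  by apply: (diamondP cy); rewrite // adj_sym.
move=> Q QR cQ.
have cliqueIQ (v : G) : v \in K' -> {in Q, forall u, adj u v} -> adj c v -> #|Q| + 2 <= #|I|.
  move=> vK Qv cv.
  have vQ : v \notin Q.
    by apply: contraL (K'K v vK) => /(subsetP QR) /RT [/TK].
  have cvQ : c \notin v |: Q.
    rewrite !inE negb_or; apply/andP; split.
      by apply: contraTneq cv => ->; rewrite adj_irrefl.
    by apply/negP => /(subsetP QR) /RT [_ _]; rewrite eqxx.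
  apply: leq_trans (cliqueI (c |: (v |: Q)) _ _).
  - by rewrite !cardsU1 cvQ vQ addnC.
  - apply/subsetP=> x /setU1P [->|/setU1P [->|/(subsetP QR) /RT [xT _ _]]];
      [exact: TD|exact: KD|exact: TD].
  - apply: clique_setU1 => [|x /setU1P [->//|/(subsetP QR) /RT [] //]].
    by apply: clique_setU1 => // x xQ; rewrite adj_sym; apply: Qv.
have cQI : #|Q| + 1 <= #|I|.
  have cQ' : c \notin Q by apply/negP => /(subsetP QR) /RT [_ _]; rewrite eqxx.
  apply: leq_trans (cliqueI (c |: Q) _ _).
  - by rewrite cardsU1 cQ' addnC.
  - apply/subsetP=> x /setU1P [->|/(subsetP QR) /RT [xT _ _]]; exact: TD.
  - by apply: clique_setU1 => // x /(subsetP QR) /RT [].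
pose forb u b := [exists v in K', adj u v && (f0 v == b)].
have cardL : #|[set~ a]| + 1 = #|I|.
  by rewrite cardsC1 addn1 prednK //; apply/card_gt0P; exists a.
(* The palette omits [a]. The conjunct [u \in Q] makes the forbidden colour unique, since feet are
   unique only outside [K]. *)
have [|||g injg gP] := @injective_choice _ _ i0 (fun u b => (u \in Q) && forb u b) Q [set~ a].
- move=> u b b' /andP [uQ /exists_inP [v vK /andP [uv /eqP <-]]].
  move=> /andP [_ /exists_inP [v' v'K /andP [uv' /eqP <-]]].
  have [uT _ _] := RT _ (subsetP QR _ uQ); by rewrite (foot' u v v').
- by rewrite -(leq_add2r 1) cardL.
- move=> Qtight /set0Pn [u uQ] b bL; apply/exists_inP; apply: contraT => nQ.
  have allQ x : x \in Q -> forb x b.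
    move=> xQ; apply: contraR nQ => nf; apply/exists_inP; exists x => //.
    by rewrite negb_and nf orbT.
  have /exists_inP [v vK /andP [uv /eqP fv]] := allQ u uQ.
  (* A colour forbidden to all of [Q] comes from one common foot [v], because [f0] is injective on
     [K']. *)
  have Qv : {in Q, forall x, adj x v}.
    move=> x /allQ /exists_inP [v' v'K /andP [xv' /eqP]].
    by rewrite -fv => /injf0 <-.
  have [uT cu uc] := RT _ (subsetP QR _ uQ).
  (* A lone vertex means two colours in all, and [a2] puts [b] outside the palette. Otherwise an
     edge of [Q] with [c] and [v] forces [c] adjacent to [v], and [Q], [c], [v] form a clique larger
     than [I]. *)
  have [Q1|/card_gt1P [x [y [xQ yQ xy]]]] := leqP #|Q| 1.
    have I2 : #|I| = 2.
      rewrite -cardL -Qtight; suff -> : #|Q| = 1 by [].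
      by apply/eqP; rewrite eqn_leq Q1 card_gt0; apply/set0Pn; exists u.
    by move: bL; rewrite !inE -fv (a2 I2 u v) ?eqxx //; apply: (subsetP QR).
  have [xT cx _] := RT _ (subsetP QR _ xQ); have [yT cy _] := RT _ (subsetP QR _ yQ).
  have cv : adj c v.
    apply: (diamondP (clique_adj _ cQ _ _ xQ yQ xy)); rewrite 1?adj_sym ?Qv //; rewrite 1?adj_sym ?Qv //.
    by apply: contraNneq cK' => ->.
  by have := cliqueIQ v vK Qv cv; rewrite -cardL Qtight -[2]/(1 + 1) addnA addn1 ltnn.
apply: (extendable_injective _ pf1 injg).
  rewrite disjoint_sym; apply/pred0P => x /=; apply/negP => /andP [/(subsetP QR) /RT [xT _ xc]].
  by rewrite !inE (negbTE xc) /= => /K'K; rewrite (negbTE (TK x xT)).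
move=> u v uQ /setU1P [->|vK] uv; have /andP [gL gf] := gP u uQ.
  by rewrite f1c; move: gL; rewrite !inE.
rewrite f1K //; apply: contra gf => /eqP E; rewrite uQ /=.
by apply/exists_inP; exists v => //; rewrite uv E eqxx.
Qed.

Lemma extendable_bipartite (T X Y : {set G}) :
  [disjoint T & K] -> complete_bipartite T X Y -> 1 < #|X| -> 1 < #|Y| ->
  (forall C : {set G}, C \subset K' :|: T -> clique C -> #|C| <= #|I|) ->
  (forall x, x \in T -> extendable K' f0 (T :\ x)) ->
  extendable K' f0 T.
Proof.
move=> dTK [TE XI YI XY] /card_gt1P [x1 [x2 [x1X x2X x12]]]
  /card_gt1P [y1 [y2 [y1Y y2Y y12]]] cliqueI IH.
have TK x : x \in T -> x \notin K by move=> xT; rewrite (disjointFr dTK).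
have K'K x : x \in K' -> x \in K by apply: (subsetP subK).
have foot' u v v' : u \in T -> v \in K' -> v' \in K' -> adj u v -> adj u v' -> v = v'.
  by move=> uT vK v'K; apply: footK; [apply: TK|apply: K'K|apply: K'K].
have XT x : x \in X -> x \in T by rewrite TE inE => ->.
have YT x : x \in Y -> x \in T by rewrite TE inE => ->; rewrite orbT.
have YX : {in Y & X, forall y x, adj y x} by move=> y x yY xX; rewrite adj_sym XY.
(* Either two vertices of a side have nested neighbourhoods in [K'], and one copies the colour of
   the other, or any two vertices of that side have different feet in [K']. *)
have private A B : T = A :|: B -> {in A &, forall x y, ~~ adj x y} ->
    {in A & B, forall x y, adj x y} ->
    extendable K' f0 T \/ {in A &, forall x x', x != x' ->
      exists2 v, v \in K' & adj x v && ~~ adj x' v}.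
  move=> TE' AI AB.
  have [/exists_inP [x xA /exists_inP [x' x'A /andP [xx' /forall_inP below]]]|none] :=
    boolP [exists x in A, exists x' in A,
      (x != x') && [forall v in K', adj x v ==> adj x' v]].
    have xT : x \in T by rewrite TE' inE xA.
    have x'T : x' \in T by rewrite TE' inE x'A.
    left; apply: (extendable_comparable _ x'T xx' _ (IH x xT)).
      by apply: contra (TK x xT); apply: K'K.
    move=> z; rewrite TE' => /setUP [zK|/setUP [zA|zB]] xz.
    - exact: (implyP (below z zK)).
    - by rewrite (negbTE (AI _ _ xA zA)) in xz.
    - exact: AB.
  right=> x x' xA x'A xx'; apply/exists_inP; apply: contraR none => nex.
  apply/exists_inP; exists x => //; apply/exists_inP; exists x' => //.
  rewrite xx'; apply/forall_inP => v vK; apply/implyP => xv.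
  by apply: contraR nex => nx'v; apply/exists_inP; exists v => //; rewrite xv.
have [//|privX] := private X Y TE XI XY.
have [|//|privY] := private Y X _ YI YX; first by rewrite setUC.
have distinct (A : {set G}) u w vu vw : {subset A <= T} ->
    {in A &, forall x x', x != x' -> exists2 v, v \in K' & adj x v && ~~ adj x' v} ->
    u \in A -> w \in A -> u != w -> vu \in K' -> vw \in K' -> adj u vu -> adj w vw -> vu != vw.
  move=> AT priv uA wA uw vuK vwK uvu wvw.
  have [v vK /andP [uv nwv]] := priv u w uA wA uw.
  by apply: contraNneq nwv => E; rewrite (foot' u v vu (AT u uA)) // E.
have two (A : {set G}) q a b : {in A &, forall x y, ~~ adj x y} -> {in A, forall x, adj q x} ->
    {subset A <= T} -> q \in T ->
    {in A &, forall x x', x != x' -> exists2 v, v \in K' & adj x v && ~~ adj x' v} ->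
    a \in A -> b \in A -> a != b -> A = [set a; b].
  move=> AI qA AT qT priv aA bA ab; apply/setP => x; rewrite !inE.
  apply/idP/orP => [xA|[] /eqP -> //].
  have [|xa] := eqVneq x a; first by left.
  have [|xb] := eqVneq x b; first by right.
  have ba : b != a by rewrite eq_sym.
  have [va vaK /andP [ava _]] := priv a b aA bA ab.
  have [vb vbK /andP [bvb _]] := priv b a bA aA ba.
  have [vx vxK /andP [xvx _]] := priv x a xA aA xa.
  case: (no_three_feet (TK q qT) (TK x (AT x xA)) (TK a (AT a aA)) (TK b (AT b bA))
    (qA x xA) (qA a aA) (qA b bA) (AI x a xA aA) (AI x b xA bA) (AI a b aA bA)
    (K'K _ vxK) (K'K _ vaK) (K'K _ vbK) xvx ava bvb).
  - exact: (distinct A x a).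
  - exact: (distinct A x b).
  - exact: (distinct A a b).
have [v1 v1K /andP [x1v1 nx2v1]] := privX _ _ x1X x2X x12.
have x21 : x2 != x1 by rewrite eq_sym.
have [v2 v2K /andP [x2v2 nx1v2]] := privX _ _ x2X x1X x21.
have v12 : v1 != v2 by apply: (distinct X x1 x2).
(* [P3_foot] applied to the path [x1], [y], [x2]. *)
have foot_y y : y \in Y -> adj y v1 \/ adj y v2.
  move=> yY; apply: (P3_foot (TK _ (XT _ x1X)) (TK _ (YT _ yY)) (TK _ (XT _ x2X))) => //;
    [exact: XY|exact: YX|exact: XI|exact: K'K|exact: K'K].
(* The vertex [y1], its foot and the vertex of [X] over that foot form a triangle. *)
have cardI : 2 < #|I|.
  have tri x v : x \in X -> v \in K' -> adj x v -> adj y1 v -> 2 < #|I|.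
    move=> xX vK xv y1v; have [cl c3] := clique3 (XY _ _ xX y1Y) xv y1v.
    rewrite -c3; apply: cliqueI => //; apply/subsetP.
    by move=> z /setUP [/set2P [] ->|/set1P ->]; rewrite inE ?(XT _ xX) ?(YT _ y1Y) ?vK ?orbT.
  by have [y1v|y1v] := foot_y y1 y1Y; [apply: (tri x1 v1)|apply: (tri x2 v2)].
have [d d1 d2] : exists2 d, d != f0 v1 & d != f0 v2.
  have : 0 < #|~: [set f0 v1; f0 v2]|.
    rewrite -(ltn_add2l #|[set f0 v1; f0 v2]|) cardsC addn0; apply: leq_trans cardI.
    by rewrite cards2 ltnS; case: (_ != _).
  by case/card_gt0P => d; rewrite !inE negb_or => /andP [d1 d2]; exists d.
have XE : X = [set x1; x2].
  by apply: (two X y1 x1 x2) => //; [move=> x xX; apply: YX|apply: YT].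
(* The vertices [x1] and [x2] exchange the colours of their feet. All of [Y] receives the third
   colour [d], safe because its feet in [K'] are [v1] and [v2]. *)
pose f z := if z \in K' then f0 z else
  if z == x1 then f0 v2 else if z == x2 then f0 v1 else d.
have K'T z : z \in T -> (z \in K') = false.
  by move=> /TK /negP zK; apply/negP => /K'K.
have fK z : z \in K' -> f z = f0 z by rewrite /f => ->.
have fx1 : f x1 = f0 v2 by rewrite /f K'T ?eqxx //; apply: XT.
have fx2 : f x2 = f0 v1 by rewrite /f K'T ?eqxx ?(negbTE x21) //; apply: XT.
have fY y : y \in Y -> f y = d.
  move=> yY; rewrite /f K'T ?YT //.
  have yx x : x \in X -> (y == x) = false.
    move=> xX; apply: contraTF (XY _ _ xX yY) => /eqP ->; by rewrite adj_irrefl.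
  by rewrite !yx.
have inj_neq u v : u \in K' -> v \in K' -> u != v -> f0 u != f0 v.
  by move=> uK vK; apply: contraNneq => /injf0 ->.
have fXK x v : x \in X -> v \in K' -> adj x v -> f x != f v.
  rewrite XE => /set2P [] -> vK xv; rewrite ?fx1 ?fx2 fK //; apply: inj_neq => //.
    by apply: contraNneq nx1v2 => ->.
  by apply: contraNneq nx2v1 => ->.
have fYK y v : y \in Y -> v \in K' -> adj y v -> f y != f v.
  move=> yY vK yv; rewrite fY // fK //.
  by case: (foot_y y yY) => yv'; rewrite (foot' y v _ (YT y yY) vK _ yv yv').
have fXY x y : x \in X -> y \in Y -> f x != f y.
  by rewrite XE => /set2P [] -> yY; rewrite ?fx1 ?fx2 fY // eq_sym.
exists f => // x y; rewrite TE => /setUP [xK|/setUP [xX|xY]] /setUP [yK|/setUP [yX|yY]] xy.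
- by rewrite !fK //; apply: proper_on_injective.
- by rewrite eq_sym; apply: fXK; rewrite // adj_sym.
- by rewrite eq_sym; apply: fYK; rewrite // adj_sym.
- exact: fXK.
- by rewrite (negbTE (XI _ _ xX yX)) in xy.
- exact: fXY.
- exact: fYK.
- by rewrite eq_sym; apply: fXY.
- by rewrite (negbTE (YI _ _ xY yY)) in xy.
Qed.

(** Induction on the size of [T]: the bound on cliques passes to subsets, a disconnected [T] is
    glued from two smaller parts, and [connected_cases] settles a connected one. *)
Lemma extendable_outside (T : {set G}) :
  [disjoint T & K] ->
  (forall C : {set G}, C \subset K' :|: T -> clique C -> #|C| <= #|I|) ->
  extendable K' f0 T.
Proof.
have [n] := ubnP #|T|; elim: n T => // n IHn T leTn dTK cliqueI.
have IH (T' : {set G}) : T' \proper T -> extendable K' f0 T'.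
  move=> ltT; have [sT _] := andP ltT; apply: IHn.
  - by rewrite ltnS in leTn; apply: leq_trans leTn; apply: proper_card.
  - exact: disjointWl dTK.
  - by move=> C CT; apply: cliqueI; apply: subset_trans CT _; apply: setUS.
have [->|T0] := eqVneq T set0.
  by exists f0 => //; rewrite setU0; apply: proper_on_injective.
have [/existsP [T1 /and4P [T1T T10 T1neq /forall_inP anti]]|conn] :=
  boolP [exists T1 : {set G}, [&& T1 \subset T, T1 != set0, T1 != T &
    [forall x in T1, forall y in T :\: T1, ~~ adj x y]]].
  rewrite -(setID T T1) (setIidPr T1T); apply: extendable_glue.
  - by move=> x y xT1; apply: (forall_inP (anti x xT1)).
  - by apply: IH; rewrite properEneq T1neq.
  - apply: IH; rewrite properEneq subsetDl andbT.
    apply: contra T10 => /eqP E; rewrite -subset0; apply/subsetP => x xT1.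
    by have := subsetP T1T x xT1; rewrite -E inE xT1.
have {}conn : connected T.
  move=> T1 T1T T10 anti; apply/eqP; apply: contraR conn => T1neq.
  apply/existsP; exists T1; rewrite T1T T10 T1neq /=.
  apply/forall_inP => x xT1; apply/forall_inP => y; exact: anti.
have [[c cT dom]|[X [Y [bip X1 Y1]]]] := connected_cases dTK T0 conn.
  exact: (extendable_dominated dTK cT).
apply: (extendable_bipartite dTK bip X1 Y1 cliqueI) => x xT.
by apply: IH; rewrite properD1.
Qed.

End Colour.

End OutsideClique.

(** * Clique number, chromatic number and perfection *)

Lemma omega_le_colorable (G : sgraph) k : colorable G k -> omega G <= k.
Proof.
case/existsP=> c /forallP cP; apply/bigmax_leqP => S /clique_adj cS.
rewrite -[k]card_ord -(@card_in_imset _ _ c S); first exact: max_card.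
move=> x y xS yS cxy; apply/eqP; apply/idPn => xy.
by have := implyP (forallP (cP x) y) (cS x y xS yS xy); rewrite cxy eqxx.
Qed.

Lemma colorable_omega_chi (G : sgraph) : colorable G (omega G) -> chi G = omega G.
Proof.
move=> colG; rewrite /chi; case: ex_minnP => k colk kmin.
by apply/eqP; rewrite eqn_leq kmin //=; apply: omega_le_colorable.
Qed.

Lemma clique_induced (G : sgraph) (S C : {set G}) :
  C \subset S -> clique C -> #|C| <= omega (induced S).
Proof.
move=> CS cC; pose C' : {set induced S} := [set x | val x \in C].
suff -> : #|C| = #|C'|.
  apply: clique_leq; apply/clique_adj => x y; rewrite !inE => xC yC xy.
  exact: (clique_adj _ cC).
have <- : val @: C' = C.
  apply/setP => x; apply/imsetP/idP => [[y]|xC]; first by rewrite inE => yC ->.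
  by exists (exist _ x (subsetP CS x xC)); rewrite ?inE.
by rewrite card_imset //; apply: val_inj.
Qed.

Theorem theorem1p4 (G : sgraph)
  (hP2P4 : free (disjoint_union (path_graph 2) (path_graph 4)) G)
  (hdiamond : free diamond G)
  (hC5 : free (cycle_graph 5) G)
  (homega : 5 <= omega G) :
  perfect G.
Proof.
have diamondP a b x y := @diamond_free_adj G a b x y hdiamond.
have C5P a b c d e := @C5_free_false G a b c d e hC5.
have [K cliqueK Kmax] : exists2 K : {set G}, clique K & #|K| = omega G.
  have c0 : clique (set0 : {set G}) by apply/clique_adj => x; rewrite inE.
  have [|K cK E] := @eq_bigmax_cond _ (fun S : {set G} => clique S) (fun S => #|S|).
    by apply/card_gt0P; exists set0.
  by exists K.
(* If [u] had two neighbours in [K], diamond-freeness would join it to every other vertex of [K],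
   and [u |: K] would exceed the maximum clique. *)
have footK u v v' : u \notin K -> v \in K -> v' \in K -> adj u v -> adj u v' -> v = v'.
  move=> uK vK v'K uv uv'; apply/eqP; apply/idPn => vv'.
  suff /clique_leq : clique (u |: K) by rewrite cardsU1 uK Kmax ltnn.
  apply: clique_setU1 => // w wK.
  have [->//|wv] := eqVneq w v; have [->//|wv'] := eqVneq w v'.
  have KA := clique_adj _ cliqueK.
  apply: (diamondP v v') => //; rewrite 1?adj_sym //; try exact: KA; try by rewrite KA // eq_sym.
  by apply: contraNneq uK => ->.
have P4P p q r s := @P4_free_outside G K C5P cliqueK footK p q r s hP2P4.
rewrite Kmax in P4P.
move=> S; apply: colorable_omega_chi.
(* The empty subgraph is coloured apart, as its palette has no default colour. In the other case the
   number of colours is [w.+1], with default [ord0]. *)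
have [S0|[x0 x0S]] := set_0Vmem S.
  have no (x : induced S) : False by case: x => x; rewrite S0 inE.
  apply/existsP; exists [ffun x => False_rect _ (no x)].
  by apply/forallP => x; case: (no x).
have := @clique_induced G S; case: (omega _) => [|w] cliqueS.
  by have := cliqueS [set x0]; rewrite sub1set cards1 => /(_ x0S (clique_set1 _)).
(* With nothing forbidden, this is just an injective colouring of [K :&: S]. *)
have [|||g injg _] := @injective_choice _ 'I_w.+1 ord0 (fun _ _ => false) (K :&: S) setT.
- by [].
- rewrite cardsT card_ord; apply: cliqueS; first exact: subsetIr.
  exact: clique_sub (subsetIl K S) cliqueK.
- by move=> _ /set0Pn [u uK] a _; exists u.
have [||f _ pf] := @extendable_outside G K diamondP C5P cliqueK footK
    (fun p q r s => @P4P p q r s homega) 'I_w.+1 ord0 (K :&: S) g (subsetIl K S) injg (S :\: K).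
- by rewrite disjoint_sym; apply/pred0P => x /=; rewrite !inE; case: (x \in K).
- by move=> C; rewrite card_ord setIC setID; apply: cliqueS.
rewrite setIC setID in pf.
apply/existsP; exists [ffun x => f (val x)].
apply/forallP => x; apply/forallP => y; apply/implyP => xy; rewrite !ffunE.
by apply: pf xy; apply: valP.
Qed.
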